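(* For every integer $n\ge 3$, the variety $\mathsf{V}(\mathbf{M}_n')$ generated by $\mathbf{M}_n'$ is axiomatized, relative to the variety $\mathcal{M}_{DM}$, by the two identities $$x_0\wedge\bigwedge_{1\le i<j\le n}(x_i\vee x_j)\le\bigvee_{1\le i\le n}(x_0\wedge x_i)$$ and $$x\wedge(\tau_n(y)\vee z)\approx(x\wedge\tau_n(y))\vee(x\wedge z).$$ That is, $\mathsf{V}(\mathbf{M}_n')$ is exactly the class of all members of $\mathcal{M}_{DM}$ that satisfy both of these identities.
   Context: A lattice with complementation is an algebra $(L,\vee,\wedge,{}',0,1)$ of type $(2,2,1,0,0)$ such that $(L,\vee,\wedge,0,1)$ is a bounded lattice and $a\vee a'=1$, $a\wedge a'=0$ for all $a\in L$. $\mathcal{M}_{DM}$ is the variety of lattices with complementation whose lattice reduct is modular and which satisfy De Morgan's laws $(x\vee y)'\approx x'\wedge y'$ and $(x\wedge y)'\approx x'\vee y'$ (the complementation need not be involutive). For an integer $n\ge 2$, $\mathbf{M}_n'$ is the lattice with complementation with universe $\{0,1,a_0,\dots,a_{n-1}\}$ (of size $n+2$), where $a_0,\dots,a_{n-1}$ form an antichain, $a_i\vee a_j=1$ and $a_i\wedge a_j=0$ for $i\neq j$, and $0'=1$, $1'=0$, $a_i'=a_{i+1}$ with $i+1$ taken modulo $n$. $\mathsf{V}(\mathbf{A})$ denotes the variety generated by the algebra $\mathbf{A}$. Put $x^{(1)}:=x'$ and $x^{(k)}:=(x^{(k-1)})'$ for $k\ge 2$. For an integer $n\ge 3$, $\tau_n(x):=\bigwedge_{2\le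 k<n}(x\vee x^{(k)})$. *)

(* Defs.v *)
From mathcomp Require Import all_boot.

Set Implicit Arguments.
Unset Strict Implicit.
Unset Printing Implicit Defensive.

(* An arbitrary algebra of type (2,2,1,0,0); the carrier is any type, with
   Leibniz equality, and no decidability is assumed. *)
Record algebra := Algebra {
  carrier :> Type;
  join : carrier -> carrier -> carrier;
  meet : carrier -> carrier -> carrier;
  compl : carrier -> carrier;
  zero : carrier;
  one : carrier
}.

Arguments zero : clear implicits.
Arguments one : clear implicits.

Record is_hom (A B : algebra) (f : A -> B) : Prop := IsHom {
  hom_join : forall x y, f (join x y) = join (f x) (f y);
  hom_meet : forall x y, f (meet x y) = meet (f x) (f y);
  hom_compl : forall x, f (compl x) = compl (f x);
  hom_zero : f (zero A) = zero B;
  hom_one : f (one A) = one B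
}.

Definition prod_algebra (I : Type) (F : I -> algebra) : algebra :=
  @Algebra (forall i, F i)
    (fun x y i => join (x i) (y i))
    (fun x y i => meet (x i) (y i))
    (fun x i => compl (x i))
    (fun i => zero (F i))
    (fun i => one (F i)).

(* Closure under H, S and P.  A subalgebra of A is given, up to isomorphism,
   by an embedding B -> A. *)
Record is_variety (K : algebra -> Prop) : Prop := IsVariety {
  variety_H : forall (A B : algebra) (f : A -> B),
    is_hom f -> (forall b, exists a, f a = b) -> K A -> K B;
  variety_S : forall (A B : algebra) (f : B -> A),
    is_hom f -> injective f -> K A -> K B;
  variety_P : forall (I : Type) (F : I -> algebra),
    (forall i, K (F i)) -> K (prod_algebra F)
}.

(* V(A), the smallest variety containing A. *)
Definition variety_generated_by (A B : algebra) : Prop :=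
  forall K, is_variety K -> K A -> K B.

Record is_bounded_lattice (A : algebra) : Prop := IsBoundedLattice {
  lat_joinC : forall x y : A, join x y = join y x;
  lat_meetC : forall x y : A, meet x y = meet y x;
  lat_joinA : forall x y z : A, join x (join y z) = join (join x y) z;
  lat_meetA : forall x y z : A, meet x (meet y z) = meet (meet x y) z;
  lat_joinK : forall x y : A, meet x (join x y) = x;
  lat_meetK : forall x y : A, join x (meet x y) = x;
  lat_join0 : forall x : A, join x (zero A) = x;
  lat_meet1 : forall x : A, meet x (one A) = x
}.

Record is_lattice_with_complementation (A : algebra) : Prop :=
  IsLatticeWithComplementation {
  lwc_lattice : is_bounded_lattice A;
  lwc_join : forall x : A, join x (compl x) = one A;
  lwc_meet : forall x : A, meet x (compl x) = zero A
}.

Definition le (A : algebra) (x y : A) : Prop := meet x y = x.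

Record M_DM (A : algebra) : Prop := IsM_DM {
  mdm_lwc : is_lattice_with_complementation A;
  mdm_modular : forall x y z : A,
    le x z -> join x (meet y z) = meet (join x y) z;
  mdm_compl_join : forall x y : A, compl (join x y) = meet (compl x) (compl y);
  mdm_compl_meet : forall x y : A, compl (meet x y) = join (compl x) (compl y)
}.

Inductive Mn_carrier (n : nat) : Type :=
  | Mn_zero
  | Mn_one
  | Mn_atom of 'I_n.

Arguments Mn_zero {n}.
Arguments Mn_one {n}.

Definition Mn_join n (x y : Mn_carrier n) : Mn_carrier n :=
  match x, y with
  | Mn_zero, z | z, Mn_zero => z
  | Mn_atom i, Mn_atom j => if i == j then Mn_atom i else Mn_one
  | _, _ => Mn_one
  end.

Definition Mn_meet n (x y : Mn_carrier n) : Mn_carrier n :=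
  match x, y with
  | Mn_one, z | z, Mn_one => z
  | Mn_atom i, Mn_atom j => if i == j then Mn_atom i else Mn_zero
  | _, _ => Mn_zero
  end.

(* [ordS i] is i + 1 modulo n. *)
Definition Mn_compl n (x : Mn_carrier n) : Mn_carrier n :=
  match x with
  | Mn_zero => Mn_one
  | Mn_one => Mn_zero
  | Mn_atom i => Mn_atom (ordS i)
  end.

Definition Mn' (n : nat) : algebra :=
  Algebra (@Mn_join n) (@Mn_meet n) (@Mn_compl n) Mn_zero Mn_one.

Inductive term : Type :=
  | Var of nat
  | Join of term & term
  | Meet of term & term
  | Compl of term
  | Zero
  | One.

Fixpoint eval (A : algebra) (v : nat -> A) (t : term) : A :=
  match t with
  | Var i => v i
  | Join s t => join (eval v s) (eval v t)
  | Meet s t => meet (eval v s) (eval v t)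
  | Compl t => compl (eval v t)
  | Zero => zero A
  | One => one A
  end.

Record identity := Identity { lhs : term; rhs : term }.

Definition satisfies (A : algebra) (e : identity) : Prop :=
  forall v : nat -> A, eval v (lhs e) = eval v (rhs e).

Declare Scope term_scope.
Delimit Scope term_scope with term.
Bind Scope term_scope with term.
Notation "s ∨ t" := (Join s t) (at level 50, left associativity) : term_scope.
Notation "s ∧ t" := (Meet s t) (at level 40, left associativity) : term_scope.
Notation "s ≈ t" := (Identity s%term t%term) (at level 70, no associativity).
(* In lattices, the inequality s <= t is the identity s ∧ t ≈ s. *)
Notation "s ≲ t" := (Identity (Meet s t) s) (at level 70, no associativity).

(* Finite meets (joins) are iterated from the unit One (Zero), which changes
   nothing in a bounded lattice; when n >= 3 the only empty range
   below is that of j when i = n. *)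
Definition tau (n : nat) (t : term) : term :=
  \big[Meet/One]_(2 <= k < n) (t ∨ iter k Compl t)%term.

Definition identity1 (n : nat) : identity :=
  (Var 0 ∧ \big[Meet/One]_(1 <= i < n.+1)
             \big[Meet/One]_(i.+1 <= j < n.+1) (Var i ∨ Var j))%term
  ≲ \big[Join/Zero]_(1 <= i < n.+1) (Var 0 ∧ Var i)%term.

Definition identity2 (n : nat) : identity :=
  let x := Var 0 in let y := Var 1 in let z := Var 2 in
  x ∧ (tau n y ∨ z) ≈ (x ∧ tau n y) ∨ (x ∧ z).

(* Main.v *)
(* For a <> b in A take a congruence maximal among those not identifying a and
   b.  The second identity makes every t = tau_n(y) central, so the congruences
   "x ∧ t ~ y ∧ t" and "x ∧ t' ~ y ∧ t'" meet in the maximal one, and one of them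
   equals it: in the quotient B every tau_n(y) is 0 or 1.  Hence y ∨ y^(k) = 1
   for y <> 0 and 1 <= k < n, and dually y ∧ y^(k) = 0 for y <> 1.  If z <= w with
   z <> 0 and w <> 0, 1, then z ∨ z'' = 1 while z'' ∧ w <= w'' ∧ w = 0, so z = w by
   modularity: w is an atom.  The first identity, applied to y, y', ..., y^(n-1),
   then leaves no other elements besides 0 and 1, and B embeds in M_n'.  So A
   embeds in a power of M_n'. *)
From mathcomp Require Import all_boot.
From mathcomp Require Import boolp classical_sets.
Require Import Defs.

Set Implicit Arguments.
Unset Strict Implicit.
Unset Printing Implicit Defensive.

(** * Order and finite meets and joins in a bounded lattice *)

Section Lattice.
Variables (A : algebra) (latA : is_bounded_lattice A).
Implicit Types x y z : A.

Lemma meetxx x : meet x x = x.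
Proof. by rewrite -{2}[x](lat_meetK latA x x) (lat_joinK latA). Qed.

Lemma join0x x : join (zero A) x = x.
Proof. by rewrite (lat_joinC latA) (lat_join0 latA). Qed.

Lemma meet1x x : meet (one A) x = x.
Proof. by rewrite (lat_meetC latA) (lat_meet1 latA). Qed.

Lemma meet0x x : meet (zero A) x = zero A.
Proof. by rewrite -{1}[x]join0x (lat_joinK latA). Qed.

Lemma meetx0 x : meet x (zero A) = zero A.
Proof. by rewrite (lat_meetC latA) meet0x. Qed.

Lemma joinx1 x : join x (one A) = one A.
Proof. by rewrite -{1}[x]meet1x (lat_joinC latA) (lat_meetK latA). Qed.

Lemma join1x x : join (one A) x = one A.
Proof. by rewrite (lat_joinC latA) joinx1. Qed.

Lemma lexx x : le x x.
Proof. exact: meetxx. Qed.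

Lemma le_trans y x z : le x y -> le y z -> le x z.
Proof. by rewrite /le => <- yz; rewrite -(lat_meetA latA) yz. Qed.

Lemma le_anti x y : le x y -> le y x -> x = y.
Proof. by move=> xy yx; rewrite -xy -{2}yx (lat_meetC latA). Qed.

Lemma le0x x : le (zero A) x.
Proof. exact: meet0x. Qed.

Lemma lex1 x : le x (one A).
Proof. exact: lat_meet1. Qed.

Lemma le_meet x y z : le x y -> le x z -> le x (meet y z).
Proof. by rewrite /le (lat_meetA latA) => ->. Qed.

Lemma meet_lel x y : le (meet x y) x.
Proof. by rewrite /le (lat_meetC latA) (lat_meetA latA) meetxx. Qed.

Lemma meet_ler x y : le (meet x y) y.
Proof. by rewrite /le -(lat_meetA latA) meetxx. Qed.

Lemma leEjoin x y : le x y <-> join x y = y.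
Proof.
split=> [<-|<-]; last exact: lat_joinK.
by rewrite (lat_joinC latA) (lat_meetC latA) (lat_meetK latA).
Qed.

Lemma joinxx x : join x x = x.
Proof. exact/leEjoin/lexx. Qed.

Lemma le_joinl x y : le x (join x y).
Proof. exact: lat_joinK. Qed.

Lemma le_joinr x y : le y (join x y).
Proof. by rewrite (lat_joinC latA); exact: le_joinl. Qed.

Lemma join_le x y z : le x z -> le y z -> le (join x y) z.
Proof. by rewrite !leEjoin -(lat_joinA latA) => xz ->. Qed.

Lemma lex0 x : le x (zero A) -> x = zero A.
Proof. by move=> x0; apply: le_anti => //; exact: le0x. Qed.

Lemma le1x x : le (one A) x -> x = one A.
Proof. by move=> x1; apply: le_anti => //; exact: lex1. Qed.

Lemma le_meets (r : seq nat) (F : nat -> A) x :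
  (forall i, i \in r -> le x (F i)) -> le x (\big[@meet A/one A]_(i <- r) F i).
Proof.
move=> xF; rewrite big_seq; elim/big_ind: _ => //; first exact: lex1.
by move=> y z; exact: le_meet.
Qed.

Lemma meets_le (r : seq nat) (F : nat -> A) i :
  i \in r -> le (\big[@meet A/one A]_(i <- r) F i) (F i).
Proof.
elim: r => // j r IHr; rewrite big_cons inE => /predU1P[->|/IHr].
  exact: meet_lel.
by apply: le_trans; exact: meet_ler.
Qed.

Lemma joins_le (r : seq nat) (F : nat -> A) x :
  (forall i, i \in r -> le (F i) x) ->
  le (\big[@join A/zero A]_(i <- r) F i) x.
Proof.
move=> Fx; rewrite big_seq; elim/big_ind: _ => //; first exact: le0x.
by move=> y z; exact: join_le.
Qed.

Lemma le_joins (r : seq nat) (F : nat -> A) i :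
  i \in r -> le (F i) (\big[@join A/zero A]_(i <- r) F i).
Proof.
elim: r => // j r IHr; rewrite big_cons inE => /predU1P[->|/IHr Fi].
  exact: le_joinl.
exact: le_trans Fi (le_joinr _ _).
Qed.

End Lattice.

(** * Evaluation of terms and element-wise forms of the two identities *)

Lemma hom_eval (A B : algebra) (f : A -> B) (v : nat -> A) t :
  is_hom f -> f (eval v t) = eval (f \o v) t.
Proof.
case=> fj fm fc f0 f1.
by elim: t => //= [s <- t <-|s <- t <-|t <-].
Qed.

Lemma eval_meets (A : algebra) (v : nat -> A) (r : seq nat) F :
  eval v (\big[Meet/One]_(i <- r) F i) =
  \big[@meet A/one A]_(i <- r) eval v (F i).
Proof. exact: (big_morph (eval v)). Qed.

Lemma eval_joins (A : algebra) (v : nat -> A) (r : seq nat) F :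
  eval v (\big[Join/Zero]_(i <- r) F i) =
  \big[@join A/zero A]_(i <- r) eval v (F i).
Proof. exact: (big_morph (eval v)). Qed.

Lemma eval_compls (A : algebra) (v : nat -> A) k t :
  eval v (iter k Compl t) = iter k (@compl A) (eval v t).
Proof. by elim: k => //= k ->. Qed.

Definition tau_op (A : algebra) (n : nat) (y : A) : A :=
  \big[@meet A/one A]_(2 <= k < n) join y (iter k (@compl A) y).

Lemma eval_tau (A : algebra) (v : nat -> A) n t :
  eval v (tau n t) = tau_op n (eval v t).
Proof.
rewrite /tau eval_meets; apply: eq_bigr => k _ /=.
by rewrite eval_compls.
Qed.

(** Any lower bound [w] may replace the iterated meet on the left, so later uses only check one pair
    [i < j] at a time. *)
Lemma satisfies_identity1 (A : algebra) n : is_bounded_lattice A ->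
  satisfies A (identity1 n) <->
  forall w x (y : nat -> A), le w x ->
    (forall i j, 0 < i < j -> j <= n -> le w (join (y i) (y j))) ->
    le w (\big[@join A/zero A]_(1 <= i < n.+1) meet x (y i)).
Proof.
move=> latA; split=> [idA w x y wx wy|idA v].
  have := idA (fun i => if i is 0 then x else y i).
  rewrite /= eval_meets eval_joins /= => mJ.
  (* The range starts at 1, so index 0, which carries [x], never occurs in it. *)
  have -> : \big[@join A/zero A]_(1 <= i < n.+1) meet x (y i) =
      \big[@join A/zero A]_(1 <= i < n.+1)
        meet x (if i is 0 then x else y i) by apply: eq_big_nat => -[|i].
  apply: (le_trans latA _ mJ); apply: (le_meet latA wx).
  apply: (le_meets latA) => i; rewrite mem_index_iota => /andP[i0 _].
  rewrite eval_meets; apply: (le_meets latA) => j.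
  rewrite mem_index_iota ltnS => /andP[ij jn].
  by case: i i0 ij => // i _; case: j jn => // j jn ij; apply: wy.
rewrite /= eval_meets eval_joins; apply: idA; first exact: meet_lel.
move=> i j /andP[i0 ij] jn; apply: (le_trans latA (meet_ler latA _ _)).
apply: (le_trans latA (meets_le latA _ (i := i) _)).
  by rewrite mem_index_iota i0 (leq_trans ij) // ltnW.
rewrite eval_meets.
apply: (meets_le latA (fun j => join (v i) (v j))).
by rewrite mem_index_iota ij ltnS.
Qed.

Lemma satisfies_identity2 (A : algebra) n :
  satisfies A (identity2 n) <->
  forall x y z : A, meet x (join (tau_op n y) z) =
    join (meet x (tau_op n y)) (meet x z).
Proof.
split=> [idA x y z|idA v].
  have := idA (fun i => if i is 0 then x else if i is 1 then y else z).
  by rewrite /= !eval_tau.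
by rewrite /= !eval_tau; exact: idA.
Qed.

(** * The algebra [Mn' n] satisfies the axioms *)

Ltac Mn_cases :=
  repeat (rewrite /= ?eqxx //=; case: eqVneq => //= ?; subst => //=);
  try match goal with H : is_true (?i != ?i) |- _ => by rewrite eqxx in H end.

Lemma Mn_lattice n : is_bounded_lattice (Mn' n).
Proof.
by split; do ![case=> [||?]] => //=; Mn_cases.
Qed.

Lemma Mn_M_DM n : 1 < n -> M_DM (Mn' n).
Proof.
move=> n1; have ordS_neq (i : 'I_n) : (i == ordS i) = false.
  apply/negP => /eqP/(congr1 val) /=.
  have [iSn|] := ltnP i.+1 n; last first.
    move=> nSi; have -> : i.+1 = n by apply/eqP; rewrite eqn_leq ltn_ord.
    by rewrite modnn => i0; move: nSi; rewrite i0 leqNgt n1.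
  by rewrite modn_small // => /eqP; rewrite eqn_leq ltnn andbF.
split; [split; first exact: Mn_lattice| | |].
- by case=> //= i; rewrite ordS_neq.
- by case=> //= i; rewrite ordS_neq.
- by move=> [||?] [||?] [||?]; rewrite /le //=; Mn_cases.
- by move=> [||?] [||?] //=; rewrite (inj_eq (@ordS_inj n)); Mn_cases.
- by move=> [||?] [||?] //=; rewrite (inj_eq (@ordS_inj n)); Mn_cases.
Qed.

Lemma iter_Mn_compl n (i : 'I_n) k :
  exists2 j : 'I_n, iter k (@compl (Mn' n)) (Mn_atom i) = Mn_atom j &
    val j = (i + k) %% n.
Proof.
elim: k => [|k [j /= -> jE]]; first by exists i; rewrite //= addn0 modn_small.
by exists (ordS j) => //=; rewrite jE -addn1 modnDml addn1 addnS.
Qed.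

(** At 0 the factor [k = 2] is already 0; at 1 every factor is 1; at an atom the [k]-th shift with
    [2 <= k < n] is a different atom, so again every factor is 1. *)
Lemma Mn_tau_op n (y : Mn' n) :
  2 < n -> tau_op n y = zero (Mn' n) \/ tau_op n y = one (Mn' n).
Proof.
move=> n2; have lat := Mn_lattice n; rewrite /tau_op; case: y => [||i].
- by left; rewrite big_ltn // (meet0x lat).
- right; apply: (le1x lat); apply: (le_meets lat) => k _.
  by rewrite (join1x lat); exact: (lexx lat).
right; apply: (le1x lat); apply: (le_meets lat) => k.
rewrite mem_index_iota => /andP[k2 kn].
have [j -> jE] := iter_Mn_compl i k; rewrite /=; case: eqP => // /(congr1 val).
rewrite /= jE => ik; have : i + 0 = i + k %[mod n].
  by rewrite -ik addn0 modn_small.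
by move/eqP; rewrite eqn_modDl mod0n modn_small //; case: k k2 {kn ik jE}.
Qed.

Lemma Mn_identity2 n : 2 < n -> satisfies (Mn' n) (identity2 n).
Proof.
move=> n2; apply/satisfies_identity2 => x y z; have lat := Mn_lattice n.
case: (Mn_tau_op y n2) => ->.
  by rewrite (meetx0 lat) !(join0x lat).
by rewrite (join1x lat) (lat_meet1 lat) (lat_meetK lat).
Qed.

(* If two of the [y i] are comparable then their join is one of them;
   otherwise they are pairwise distinct atoms, so every atom occurs. *)
Lemma Mn_identity1 n : 1 < n -> satisfies (Mn' n) (identity1 n).
Proof.
move=> n1; have lat := Mn_lattice n; apply/(satisfies_identity1 _ lat).
move=> w x y wx wy; set J := \big[_/_]_(_ <- _) _.
have leJ i : 0 < i <= n -> le (meet x (y i)) J.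
  move=> i0n; apply: (le_joins lat (fun i => meet x (y i))).
  by rewrite mem_index_iota.
have [[i [j [i0n j0n ij yij]]]|Nle] := pselect (exists i j,
    [/\ 0 < i <= n, 0 < j <= n, i != j & le (y i) (y j)]).
  apply: (le_trans lat _ (leJ j j0n)); apply: (le_meet lat wx).
  move/(leEjoin lat): yij => yE; move: i0n j0n => /andP[i0 ni] /andP[j0 nj].
  rewrite -yE; case: ltngtP ij => // ij _.
    by apply: wy => //; rewrite i0.
  by rewrite (lat_joinC lat); apply: wy => //; rewrite j0.
have atomic (i : 'I_n) : exists a, y i.+1 = Mn_atom a.
  (* With a second index at hand, a value 0 or 1 would be comparable with the value there. *)
  have [j ij] : exists j : 'I_n, i != j.
    exists (ordS i); apply/eqP => iS.
    by have := lwc_join (mdm_lwc (Mn_M_DM n1)) (Mn_atom i); rewrite /= -iS eqxx.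
  case yE : (y i.+1) => [||a]; last by exists a.
    by case: Nle; exists i.+1, j.+1; rewrite yE; split;
      rewrite ?ltn_ord //; exact: (le0x lat).
  case: Nle; exists j.+1, i.+1; rewrite yE eq_sym; split; rewrite ?ltn_ord //.
  exact: (lex1 lat).
have [a aE] := choice atomic.
have a_inj : injective a.
  move=> i j aij; apply/eqP/negPn/negP => ij; case: Nle.
  exists i.+1, j.+1; rewrite !aE aij; split; rewrite ?ltn_ord //.
  exact: (lexx lat).
(* For [x = 1], two distinct atoms already join to 1. For an atom [x], the injective self-map [a] of
   the finite type ['I_n] is onto, so [x] is one of the [y i]. *)
have xJ : le x J.
  case: x {wx} @J leJ => [||b] J leJ.
  - exact: (le0x lat).
  - suff -> : J = one (Mn' n) by exact: (lexx lat).
    have := leJ 1; have := leJ 2; rewrite n1 (ltnW n1) !(meet1x lat).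
    move=> /(_ isT) y2J /(_ isT) y1J; apply: (le1x lat).
    have <- : join (y 1) (y 2) = one (Mn' n).
      rewrite (aE (Ordinal (ltnW n1))) (aE (Ordinal n1)) /=.
      by case: eqP => // /a_inj.
    exact: (join_le lat).
  - have := leJ (invF a_inj b).+1 (ltn_ord _).
    by rewrite aE f_invF (meetxx lat).
exact: (le_trans lat wx xJ).
Qed.

(** * Equational classes are varieties *)

Lemma is_varietyI (K1 K2 : algebra -> Prop) :
  is_variety K1 -> is_variety K2 -> is_variety (fun A => K1 A /\ K2 A).
Proof.
move=> [H1 S1 P1] [H2 S2 P2]; split.
- by move=> A B f fh fs [k1 k2]; split; [exact: H1 fh fs k1|exact: H2 fh fs k2].
- by move=> A B f fh fi [k1 k2]; split; [exact: S1 fh fi k1|exact: S2 fh fi k2].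
- by move=> I F k; split; [apply: P1|apply: P2] => i; case: (k i).
Qed.

Lemma eval_prod (I : Type) (F : I -> algebra) (v : nat -> prod_algebra F) t i :
  eval v t i = eval (fun k => v k i) t.
Proof. by elim: t => //= [s -> t ->|s -> t ->|t ->]. Qed.

Lemma satisfies_variety e : is_variety (fun A => satisfies A e).
Proof.
split=> [A B f fh fs Ae v|A B f fh fi Ae v|I F Fe v].
- have [u uE] := choice (fun k => fs (v k)).
  have -> : v = f \o u by apply: funext => k /=; rewrite uE.
  by rewrite -!(hom_eval _ _ fh) Ae.
- by apply: fi; rewrite !(hom_eval _ _ fh).
- apply: functional_extensionality_dep => i; rewrite !eval_prod; exact: Fe.
Qed.

Fixpoint satisfies_all (A : algebra) (es : seq identity) : Prop :=
  if es is e :: es' then satisfies A e /\ satisfies_all A es' else True.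

Lemma satisfies_all_variety es : is_variety (satisfies_all^~ es).
Proof. by elim: es => //= e es; exact/is_varietyI/satisfies_variety. Qed.

(* The last identity but two is the modular law with [x <= z] encoded by
   writing [x ∨ z] for [z]. *)
Definition M_DM_identities : seq identity :=
  let x := Var 0 in let y := Var 1 in let z := Var 2 in
  [:: x ∨ y ≈ y ∨ x; x ∧ y ≈ y ∧ x;
      x ∨ (y ∨ z) ≈ x ∨ y ∨ z; x ∧ (y ∧ z) ≈ x ∧ y ∧ z;
      x ∧ (x ∨ y) ≈ x; x ∨ (x ∧ y) ≈ x; x ∨ Zero ≈ x; x ∧ One ≈ x;
      x ∨ Compl x ≈ One; x ∧ Compl x ≈ Zero;
      x ∨ (y ∧ (x ∨ z)) ≈ (x ∨ y) ∧ (x ∨ z);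
      Compl (x ∨ y) ≈ Compl x ∧ Compl y;
      Compl (x ∧ y) ≈ Compl x ∨ Compl y].

(** The modular law of [M_DM] is an implication, from which closure under quotients cannot be read
    off; the equational form gives it. *)
Lemma M_DM_equational (A : algebra) :
  M_DM A <-> satisfies_all A M_DM_identities.
Proof.
split=> [[[lat ? ?] Amod ? ?]|].
  case: (lat) => *; rewrite /= /satisfies /=; do ![split=> //] => v.
  by apply: Amod; exact: le_joinl.
case=> jC [mC [jA [mA [jK [mK [j0 [m1 [jc [mc [Amod [cj [cm _]]]]]]]]]]]].
(* The default value of [nth] serves as the value of [Var 2]. *)
pose v x y z : nat -> A := nth z [:: x; y].
split; [split; [split|..]|..].
- by move=> x y; exact: (jC (v x y x)).
- by move=> x y; exact: (mC (v x y x)).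
- by move=> x y z; exact: (jA (v x y z)).
- by move=> x y z; exact: (mA (v x y z)).
- by move=> x y; exact: (jK (v x y x)).
- by move=> x y; exact: (mK (v x y x)).
- by move=> x; exact: (j0 (v x x x)).
- by move=> x; exact: (m1 (v x x x)).
- by move=> x; exact: (jc (v x x x)).
- by move=> x; exact: (mc (v x x x)).
- move=> x y z xz; have := Amod (v x y z); rewrite /=.
  suff -> : join x z = z by [].
  rewrite -xz; apply: etrans (jC (v (meet x z) z x)) _.
  by have /= -> := mC (v x z x); exact: (mK (v z x x)).
- by move=> x y; exact: (cj (v x y x)).
- by move=> x y; exact: (cm (v x y x)).
Qed.

Lemma M_DM_variety : is_variety M_DM.
Proof.
have -> : M_DM = satisfies_all^~ M_DM_identities.
  by apply: funext => A; apply/propext/M_DM_equational.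
exact: satisfies_all_variety.
Qed.

(** The three conditions together cut out a variety containing [Mn' n], hence one that contains the
    generated variety. *)
Lemma Mn_variety_axioms n (A : algebra) : 2 < n ->
  variety_generated_by (Mn' n) A ->
  [/\ M_DM A, satisfies A (identity1 n) & satisfies A (identity2 n)].
Proof.
move=> n2 VA; have := VA (fun B => M_DM B /\
  (satisfies B (identity1 n) /\ satisfies B (identity2 n))).
case=> [||? []//].
  by do ![exact: satisfies_variety|exact: M_DM_variety|apply: is_varietyI].
have n1 := ltnW n2.
by split; [exact: Mn_M_DM|split; [exact: Mn_identity1|exact: Mn_identity2]].
Qed.

(** * Standard elements in modular lattices with De Morgan complementation *)

Section Modular.
Variables (A : algebra) (mdmA : M_DM A).
Let latA : is_bounded_lattice A := lwc_lattice (mdm_lwc mdmA).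
Let joinc := lwc_join (mdm_lwc mdmA).
Let meetc := lwc_meet (mdm_lwc mdmA).
Implicit Types x y z : A.

Lemma compl_eq0 x : compl x = zero A -> x = one A.
Proof. by move=> x0; rewrite -(joinc x) x0 (lat_join0 latA). Qed.

Lemma compl_eq1 x : compl x = one A -> x = zero A.
Proof. by move=> x1; rewrite -(meetc x) x1 (lat_meet1 latA). Qed.

Lemma compl1 : compl (one A) = zero A.
Proof. by rewrite -(meetc (one A)) (meet1x latA). Qed.

Lemma compl0 : compl (zero A) = one A.
Proof. by rewrite -(joinc (zero A)) (join0x latA). Qed.

Lemma le_compl2 x y : le x y -> le (compl (compl x)) (compl (compl y)).
Proof.
by rewrite /le => <-; rewrite !(mdm_compl_meet, mdm_compl_join) //
  -?(lat_meetA latA) (meetxx latA).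
Qed.

(** These are the standard elements of lattice theory; the second identity says that every value of
    [tau_op n] is one. *)
Definition standard t : Prop :=
  forall x z, meet x (join t z) = join (meet x t) (meet x z).

(* In a modular lattice distributivity of one triple passes to all the others. *)
Lemma standard_distr t x y : standard t ->
  meet (join x y) t = join (meet x t) (meet y t).
Proof.
(* Modularity turns the right side into [y ∨ (x ∧ (y ∨ t))]; standardness splits the inner meet, and
   [x ∧ y] is absorbed by [y]. *)
move=> tS; have dual : join y (meet x t) = meet (join y x) (join y t).
  rewrite -(mdm_modular mdmA x (le_joinl latA y t)) (lat_joinC latA y t) tS.
  rewrite (lat_joinC latA (meet x t)) (lat_joinA latA) (lat_meetC latA x y).
  by rewrite (lat_meetK latA).
have -> : meet (join x y) t = meet (join y (meet x t)) t.
  rewrite dual -(lat_meetA latA) (lat_meetC latA (join y t)) (lat_joinC latA y t).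
  by rewrite (lat_joinK latA) (lat_joinC latA).
by rewrite (lat_joinC latA) -(mdm_modular mdmA y (meet_ler latA x t)).
Qed.

(** Only [t] is known to be standard, so its complement [s] is handled through [t]. Since
    [t ∨ s = 1], every [z] lies below [t ∨ (z ∧ s)]; hence [x ∨ y] lies below [t ∨ u], where [u] is
    the right side, and meeting with [s] removes [t]. *)
Lemma standard_distr_compl t x y : standard t ->
  meet (join x y) (compl t) = join (meet x (compl t)) (meet y (compl t)).
Proof.
move=> tS; set s := compl t.
have le_t z : le z (join t (meet z s)).
  have zE : z = join (meet z t) (meet z s).
    by rewrite -tS joinc (lat_meet1 latA).
  rewrite {1}zE; apply: join_le => //; last exact: le_joinr.
  exact: le_trans (meet_ler latA _ _) (le_joinl latA _ _).
apply: le_anti => //.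
  set u := join (meet x s) _.
  have ust : le (join x y) (join t u).
    apply: (join_le latA); apply: (le_trans latA (le_t _)); apply: (join_le latA).
    - exact: le_joinl.
    - exact: (le_trans latA (le_joinl latA _ _) (le_joinr latA _ _)).
    - exact: le_joinl.
    - exact: (le_trans latA (le_joinr latA _ _) (le_joinr latA _ _)).
  have sut : meet s (join t u) = meet s u.
    by rewrite tS (lat_meetC latA s t) meetc (join0x latA).
  apply: (le_trans latA _ (meet_ler latA s u)); rewrite -sut.
  apply: (le_meet latA); first exact: meet_ler.
  exact: (le_trans latA (meet_lel latA _ _) ust).
by apply: (join_le latA); apply: (le_meet latA);
  by [exact: meet_ler | apply: (le_trans latA (meet_lel latA _ _));
    first [exact: le_joinl | exact: le_joinr]].
Qed.

End Modular.

(** * Congruences, maximal separating congruences and quotients *)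

Record is_congruence (A : algebra) (R : A -> A -> Prop) : Prop := IsCongruence {
  cong_refl : forall x, R x x;
  cong_sym : forall x y, R x y -> R y x;
  cong_trans : forall x y z, R x y -> R y z -> R x z;
  cong_join : forall x x' y y', R x x' -> R y y' -> R (join x y) (join x' y');
  cong_meet : forall x x' y y', R x x' -> R y y' -> R (meet x y) (meet x' y');
  cong_compl : forall x y, R x y -> R (compl x) (compl y)
}.

(** Meeting with [c] preserves joins by assumption and meets always. For complements, De Morgan and
    the assumption give [x' ∧ c = (x ∧ c)' ∧ c], so [x' ∧ c] depends on [x ∧ c] only. *)
Lemma meet_congruence (A : algebra) (R : A -> A -> Prop) (c : A) :
  M_DM A -> is_congruence R ->
  (forall x y, meet (join x y) c = join (meet x c) (meet y c)) ->
  is_congruence (fun x y => R (meet x c) (meet y c)).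
Proof.
move=> mdmA [Rr Rs Rt Rj Rm Rc] cD.
have lat := lwc_lattice (mdm_lwc mdmA).
have meetI x y : meet (meet x y) c = meet (meet x c) (meet y c).
  rewrite -(lat_meetA lat x c) (lat_meetA lat c y) (lat_meetC lat c y).
  by rewrite -(lat_meetA lat y c) (meetxx lat) (lat_meetA lat).
have complI x : meet (compl x) c = meet (compl (meet x c)) c.
  rewrite (mdm_compl_meet mdmA) cD (lat_meetC lat _ c).
  by rewrite (lat_meetC lat (compl c)) (lwc_meet (mdm_lwc mdmA)) (lat_join0 lat).
split=> [x|x y|x y z|x x' y y' xx' yy'|x x' y y' xx' yy'|x y xy].
- exact: Rr.
- exact: Rs.
- exact: Rt.
- by rewrite !cD; exact: Rj.
- by rewrite !meetI; exact: Rm.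
- by rewrite complI (complI y); apply: Rm => //; exact: Rc.
Qed.

Lemma maximal_congruence (A : algebra) (a b : A) : a <> b ->
  exists R : A -> A -> Prop, [/\ is_congruence R, ~ R a b &
    forall Q : A -> A -> Prop, is_congruence Q ->
      (forall x y, R x y -> Q x y) -> ~ Q a b -> forall x y, Q x y -> R x y].
Proof.
move=> ab.
(* The diagonal is added so that the empty chain has an upper bound. *)
pose rel (S : set (A * A)) x y := x = y \/ S (x, y).
pose P S := is_congruence (rel S) /\ ~ rel S a b.
have [S [[RS nab] maxS]] : exists S, P S /\ forall T, (S `<` T)%classic -> ~ P T.
  apply: Zorn_bigcup => F FP Ftot.
  set U := (\bigcup_(X in F) X)%classic.
  have relU X x y : F X -> rel X x y -> rel U x y.
    by move=> FX [|]; [left|right; exists X].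
  have relUP x y : rel U x y -> x = y \/ exists2 X, F X & rel X x y.
    by case=> [|[X FX Xxy]]; [left|right; exists X => //; right].
  (* Two pairs of the union lie in a common member of the chain unless both are diagonal;
     transitivity and the binary operations need this. *)
  have relU2 x y x' y' : rel U x y -> rel U x' y' -> (x = y /\ x' = y') \/
      exists2 X, F X & rel X x y /\ rel X x' y'.
    move=> /relUP[xy|[X FX Xxy]] /relUP[xy'|[Y FY Yxy]].
    - by left.
    - by right; exists Y => //; split=> //; left.
    - by right; exists X => //; split=> //; left.
    - right; case: (Ftot _ _ FX FY) => [XY|YX].
      + exists Y => //; split=> //; case: Xxy => [|/XY]; [by left|by right].
      + exists X => //; split=> //; case: Yxy => [|/YX]; [by left|by right].
  split; last first.
    by case=> // -[X FX Xab]; case: (FP _ FX) => _; apply; right.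
  split.
  - by left.
  - move=> x y xy; case: (relUP _ _ xy) => [->|[X FX]]; first by left.
    by case: (FP _ FX) => XC _ /(cong_sym XC); exact: relU.
  - move=> x y z xy yz; case: (relU2 _ _ _ _ xy yz) => [[-> ->]|[X FX]].
      by left.
    case: (FP _ FX) => XC _ [Xxy Xyz].
    exact: relU FX (cong_trans XC Xxy Xyz).
  - move=> x x' y y' xy yz; case: (relU2 _ _ _ _ xy yz) => [[-> ->]|[X FX]].
      by left.
    case: (FP _ FX) => XC _ [Xxy Xyz].
    exact: relU FX (cong_join XC Xxy Xyz).
  - move=> x x' y y' xy yz; case: (relU2 _ _ _ _ xy yz) => [[-> ->]|[X FX]].
      by left.
    case: (FP _ FX) => XC _ [Xxy Xyz].
    exact: relU FX (cong_meet XC Xxy Xyz).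
  - move=> x y xy; case: (relUP _ _ xy) => [->|[X FX]]; first by left.
    by case: (FP _ FX) => XC _ /(cong_compl XC); exact: relU.
exists (rel S); split=> // Q QC RQ nQab x y Qxy; apply: contrapT => nRxy.
(* If [Q] related a pair outside [rel S], its graph would properly contain [S]. *)
apply: (maxS [set p | Q p.1 p.2]%classic).
  split=> [[u v] Suv|QS]; first by apply: RQ; right.
  by apply: nRxy; right; exact: (QS (x, y)).
have relQ u v : rel [set p | Q p.1 p.2]%classic u v <-> Q u v.
  by split=> [[->|//]|]; [exact: cong_refl|right].
split; last by move/relQ.
case: QC => Qr Qs Qt Qj Qm Qc; split.
- by left.
- by move=> u v /relQ/Qs/relQ.
- by move=> u v w /relQ uv /relQ vw; apply/relQ/Qt/vw.
- by move=> u u' v v' /relQ uv /relQ vw; apply/relQ/Qj.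
- by move=> u u' v v' /relQ uv /relQ vw; apply/relQ/Qm.
- by move=> u v /relQ/Qc/relQ.
Qed.

(** The carrier consists of the classes [R x] as predicates, so extensionality identifies related
    elements. Operations act on chosen representatives; compatibility of [R] makes the choice
    immaterial. *)
Lemma quotient_algebra (A : algebra) (R : A -> A -> Prop) : is_congruence R ->
  exists (B : algebra) (f : A -> B),
    [/\ is_hom f, forall b, exists a, f a = b & forall x y, f x = f y <-> R x y].
Proof.
case=> Rr Rs Rt Rj Rm Rc.
pose T := {X : A -> Prop | exists x, X = R x}.
pose f x : T := exist _ (R x) (ex_intro _ x erefl).
pose r (q : T) : A := projT1 (cid (svalP q)).
have fR x y : f x = f y <-> R x y.
  split=> [/(congr1 sval) /= Rxy|xy]; first by rewrite Rxy.
  apply: eq_exist; apply: funext => z; apply/propext; split; last exact: Rt.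
  by apply: Rt; exact: Rs.
have rK q : f (r q) = q.
  by rewrite /r; case: cid; case: q => X XE x /= XR; exact: eq_exist.
have Rr' x : R (r (f x)) x by apply/fR/rK.
exists (@Algebra T (fun p q => f (join (r p) (r q)))
  (fun p q => f (meet (r p) (r q))) (fun p => f (compl (r p)))
  (f (zero A)) (f (one A))), f.
split=> // [|q]; last by exists (r q); exact: rK.
split=> //= [x y|x y|x]; apply/fR/Rs.
- exact: Rj.
- exact: Rm.
- exact: Rc.
Qed.

(** * Algebras in which [tau_op n] takes only the values 0 and 1 *)

Section TwoValuedTau.
Variables (n : nat) (B : algebra).
Hypotheses (n2 : 2 < n) (mdmB : M_DM B) (id1B : satisfies B (identity1 n)).
Hypothesis tauB : forall y : B, tau_op n y = zero B \/ tau_op n y = one B.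
Let lat : is_bounded_lattice B := lwc_lattice (mdm_lwc mdmB).
Implicit Types x y z w : B.

Definition proper y := y <> zero B /\ y <> one B.

Lemma proper_compl y : proper y -> proper (compl y).
Proof. by move=> [y0 y1]; split=> [/(compl_eq0 mdmB)|/(compl_eq1 mdmB)]. Qed.

Lemma proper_iter k y : proper y -> proper (iter k (@compl B) y).
Proof. by move=> py; elim: k => //= k; exact: proper_compl. Qed.

(** The case [k = 1] is the complement law. For larger [k] the join is a factor of [tau_op n y],
    which is not 0 because it lies above [y], hence is 1. *)
Lemma join_iter y k : y <> zero B -> 0 < k < n ->
  join y (iter k (@compl B) y) = one B.
Proof.
move=> y0; case: k => // -[|k] kn; first exact: (lwc_join (mdm_lwc mdmB)).
have le_tau i : 1 < i < n -> le (tau_op n y) (join y (iter i (@compl B) y)).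
  move=> i_n; apply: (meets_le lat (fun i => join y (iter i (@compl B) y))).
  by rewrite mem_index_iota.
case: (tauB y) => tauE; last first.
  by apply: (le1x lat); rewrite -tauE; exact: le_tau.
have ley : le y (tau_op n y).
  by apply: (le_meets lat) => i _; exact: le_joinl.
by case: y0; apply: (lex0 lat); rewrite -tauE.
Qed.

(** By De Morgan the complement of this meet is the join of [join_iter] for [compl y], and an
    element with complement 1 is 0. *)
Lemma meet_iter y k : proper y -> 0 < k < n ->
  meet y (iter k (@compl B) y) = zero B.
Proof.
move=> py kn; apply: (compl_eq1 mdmB).
rewrite (mdm_compl_meet mdmB) -iterS iterSr; apply: join_iter kn.
by case: (proper_compl py).
Qed.

Lemma proper_minimal w z : proper w -> le z w -> z <> zero B -> z = w.
Proof.
move=> pw zw z0; pose z2 := compl (compl z).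
have wz2 : meet z2 w = zero B.
  apply: (lex0 lat); rewrite -(@meet_iter w 2) //=.
  apply: (le_meet lat); first exact: meet_ler.
  by apply: (le_trans lat (meet_lel lat _ _)); exact: le_compl2.
(* The condition [0 < 2 < n] computes to [2 < n], so [n2] proves it. *)
have zz2 : join z z2 = one B := @join_iter z 2 z0 n2.
rewrite -[w](meet1x lat) -zz2 -(mdm_modular mdmB) // wz2.
by rewrite (lat_join0 lat).
Qed.

Section Orbit.
Variables (y : B) (py : proper y).
Let Y k := iter k (@compl B) y.

(** By symmetry [i < j]; then [Y j] is the complement iterated [j - i] times on the proper element
    [Y i]. *)
Lemma orbit_meet i j : i < n -> j < n -> i != j -> meet (Y i) (Y j) = zero B.
Proof.
move=> i_n jn; wlog ij : i j i_n jn / i < j.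
  move=> W; case: ltngtP => // ij _; first by apply: W; rewrite // ltn_eqF.
  by rewrite (lat_meetC lat); apply: W; rewrite // ltn_eqF.
move=> _; rewrite /Y -(subnK (ltnW ij)) iterD; apply: meet_iter.
  exact: proper_iter.
by rewrite subn_gt0 ij /= (leq_ltn_trans (leq_subr _ _)).
Qed.

Lemma orbit_join i j : i < n -> j < n -> i != j -> join (Y i) (Y j) = one B.
Proof.
move=> i_n jn; wlog ij : i j i_n jn / i < j.
  move=> W; case: ltngtP => // ij _; first by apply: W; rewrite // ltn_eqF.
  by rewrite (lat_joinC lat); apply: W; rewrite // ltn_eqF.
move=> _; rewrite /Y -(subnK (ltnW ij)) iterD; apply: join_iter.
  by case: (proper_iter i py).
by rewrite subn_gt0 ij /= (leq_ltn_trans (leq_subr _ _)).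
Qed.

(** The first identity with the orbit as its variables puts [x] below the join of the [x ∧ Y i]. One
    of these is not 0, and by minimality it equals both [x] and [Y i]. *)
Lemma orbit_all x : proper x -> exists2 i, i < n & x = Y i.
Proof.
(* The identity numbers its variables from 1, the orbit from 0, hence [i.-1]. *)
move=> px; have xle : le x (\big[@join B/zero B]_(1 <= i < n.+1) meet x (Y i.-1)).
  move/(satisfies_identity1 n lat) : id1B; apply; first exact: (lexx lat).
  move=> [|i] [|j] //= ij jn; rewrite orbit_join //; first exact: (lex1 lat).
  - exact: (@ltn_trans j).
  - by rewrite ltn_eqF.
apply: contrapT => Nx; case: (px) => x0 _; apply: x0; apply: (lex0 lat).
apply: (le_trans lat xle); apply: (joins_le lat) => i.
rewrite mem_index_iota => /andP[i0 i_n].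
have [->|mx0] := pselect (meet x (Y i.-1) = zero B); first exact: (lexx lat).
have mY := proper_minimal (proper_iter i.-1 py) (meet_ler lat _ _) mx0.
have mX := proper_minimal px (meet_lel lat _ _) mx0.
by case: Nx; exists i.-1; [case: i i0 i_n {mx0 mX mY} | rewrite -mX].
Qed.

(** [Y n] is proper, hence some [Y i] with [i < n]. If [i > 0], it is also the complement of [Y i]
    iterated [n - i < n] times, hence disjoint from [Y i], which forces [Y i = 0]. *)
Lemma orbit_period : Y n = Y 0.
Proof.
have [i i_n YniE] := orbit_all (proper_iter n py).
have [i0|i0] := posnP i; first by rewrite /Y YniE i0.
have : meet (Y i) (Y n) = zero B.
  rewrite /Y -(subnK (ltnW i_n)) iterD; apply: meet_iter.
    exact: proper_iter.
  by rewrite subn_gt0 i_n ltn_subrL i0 (leq_trans _ n2).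
rewrite /Y YniE (meetxx lat) => Yi0.
by case: (proper_iter i py) => /(_ Yi0).
Qed.

Definition orbit_map (x : Mn' n) : B :=
  match x with
  | Mn_zero => zero B
  | Mn_one => one B
  | Mn_atom i => Y i
  end.

Lemma orbit_map_hom : is_hom orbit_map.
Proof.
split=> //.
- move=> [||i] [||j] /=;
    rewrite ?(join0x lat, lat_join0 lat, join1x lat, joinx1 lat) //.
  case: eqVneq => [->|ij] /=; first by rewrite (joinxx lat).
  by rewrite orbit_join.
- move=> [||i] [||j] /=;
    rewrite ?(meet0x lat, lat_meet1 lat, meet1x lat, meetx0 lat) //.
  case: eqVneq => [->|ij] /=; first by rewrite (meetxx lat).
  by rewrite orbit_meet.
- move=> [||i] /=; rewrite ?(compl0 mdmB) ?(compl1 mdmB) //.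
  (* [ordS] wraps around only at the last atom; there the period of the orbit is needed. *)
  have [iSn|] := ltnP i.+1 n; first by rewrite modn_small.
  move=> nSi; have iSn : i.+1 = n by apply/eqP; rewrite eqn_leq ltn_ord.
  by rewrite iSn modnn -orbit_period -{1}iSn.
Qed.

Lemma orbit_map_inj : injective orbit_map.
Proof.
have neq01 : zero B <> one B.
  by case: py => y0 _ B01; apply: y0; rewrite -(lat_meet1 lat y) -B01 (meetx0 lat).
have pY i : proper (Y i) by exact: proper_iter.
move=> [||i] [||j] //=; try by [move/esym|case: (pY i)|
  move/esym; case: (pY j)].
move=> Yij; congr Mn_atom; apply/eqP/negPn/negP => /(orbit_meet (ltn_ord i)).
by move=> /(_ (ltn_ord j)); rewrite Yij (meetxx lat); case: (pY j).
Qed.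

Lemma orbit_map_surj x : exists u, orbit_map u = x.
Proof.
have [->|x0] := pselect (x = zero B); first by exists Mn_zero.
have [->|x1] := pselect (x = one B); first by exists Mn_one.
by have [//|i i_n ->] := @orbit_all x; exists (Mn_atom (Ordinal i_n)).
Qed.

End Orbit.

(** With a proper element, the orbit map is a bijective homomorphism and its inverse is the
    embedding. Without one, [B] has only the elements 0 and 1. *)
Lemma embedding_Mn : zero B <> one B ->
  exists2 f : B -> Mn' n, is_hom f & injective f.
Proof.
move=> neq01; have [[y py]|Np] := pselect (exists y, proper y).
  have [f fK] := choice (orbit_map_surj py).
  have gI := orbit_map_inj py; have [gj gm gc g0 g1] := orbit_map_hom py.
  exists f; last exact: can_inj fK.
  by split=> *; apply: gI; rewrite ?(gj, gm, gc) !fK.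
have xP x : x = zero B \/ x = one B.
  have [|x0] := pselect (x = zero B); first by left.
  by right; apply: contrapT => x1; apply: Np; exists x.
pose f x : Mn' n := if pselect (x = zero B) then Mn_zero else Mn_one.
have f0 : f (zero B) = Mn_zero by rewrite /f; case: pselect.
have f1 : f (one B) = Mn_one by rewrite /f; case: pselect => //= /esym.
exists f; last by move=> x y; case: (xP x) (xP y) => -> [] ->; rewrite ?f0 ?f1.
by split=> // [x y|x y|x]; case: (xP x) => ->; try case: (xP y) => ->;
  rewrite ?(join0x lat, join1x lat, meet0x lat, meet1x lat, compl0 mdmB,
    compl1 mdmB) ?f0 ?f1.
Qed.

End TwoValuedTau.

(** * Separation of points by homomorphisms into [Mn' n], and the axiomatization *)

Lemma separating_hom n (A : algebra) (a b : A) : 2 < n -> M_DM A ->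
  satisfies A (identity1 n) -> satisfies A (identity2 n) -> a <> b ->
  exists2 f : A -> Mn' n, is_hom f & f a <> f b.
Proof.
move=> n2 mdmA id1A id2A ab.
have lat := lwc_lattice (mdm_lwc mdmA).
have [R [RC nRab maxR]] := maximal_congruence ab.
have [Rr Rs Rt Rj Rm Rc] := RC.
have tauR (y : A) : R (tau_op n y) (zero A) \/ R (tau_op n y) (one A).
  set t := tau_op n y; have tS : standard t.
    by move=> x z; move/satisfies_identity2 : id2A; apply.
  pose Q c x z := R (meet x c) (meet z c).
  (* By maximality [Q c] is contained in [R], and [Q c] relates [c] to 1 because both meet [c] in
     [c]. *)
  have max_meet c :
      (forall x z, meet (join x z) c = join (meet x c) (meet z c)) ->
      ~ Q c a b -> R c (one A).
    move=> cD nQab; apply: (maxR (Q c)) => //.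
    - exact: meet_congruence.
    - by move=> x z; rewrite /Q => xz; exact: Rm.
    - by rewrite /Q (meetxx lat) (meet1x lat).
  have [Qt|] := pselect (Q t a b); last first.
    by right; apply: max_meet => // x z; exact: standard_distr.
  have [Qc|] := pselect (Q (compl t) a b).
    (* If both congruences related [a] and [b], joining the two components along [t] and its
       complement would give [R a b]. *)
    have aE x : x = join (meet x t) (meet x (compl t)).
      by rewrite -tS (lwc_join (mdm_lwc mdmA)) (lat_meet1 lat).
    by case: nRab; rewrite (aE a) (aE b); exact: Rj.
  (* Here [R] relates 1 to the complement of [t]; meeting with [t] gives that [R] relates [t] to
     0. *)
  move=> nQc; left; have := max_meet (compl t) _ nQc => /(_ _)/Rs.
  have cD x z := standard_distr_compl mdmA x z tS.
  move=> /(_ cD) /(Rm _ _ _ _ (Rr t)).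
  by rewrite (lat_meet1 lat) (lwc_meet (mdm_lwc mdmA)).
have [B [f [fh fs fR]]] := quotient_algebra RC.
have mdmB : M_DM B := variety_H M_DM_variety fh fs mdmA.
have id1B : satisfies B (identity1 n).
  exact: (variety_H (satisfies_variety _) fh fs id1A).
have fab : f a <> f b by move/fR.
have [|neq01|g gh gI] := embedding_Mn n2 mdmB id1B.
- move=> b'; have [y <-] := fs b'.
  have -> : tau_op n (f y) = f (tau_op n y).
    have := hom_eval (fun=> y) (tau n (Var 0)) fh.
    by rewrite !eval_tau.
  by rewrite -(hom_zero fh) -(hom_one fh) !fR.
- have latB := lwc_lattice (mdm_lwc mdmB); apply: fab.
  by rewrite -[f a](lat_meet1 latB) -[f b](lat_meet1 latB) -neq01 !(meetx0 latB).
exists (g \o f); last by move=> /gI.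
case: fh gh => fj fm fc f0 f1 [gj gm gc g0 g1].
by split=> * /=; rewrite ?(fj, fm, fc, f0, f1).
Qed.

Theorem theorem6p4 (n : nat) (hn : 3 <= n) (A : algebra) :
  variety_generated_by (Mn' n) A <->
  [/\ M_DM A, satisfies A (identity1 n) & satisfies A (identity2 n)].
Proof.
split; first exact: Mn_variety_axioms.
move=> [mdmA id1A id2A] K [_ KS KP] KM.
(* There is one factor for each pair of distinct elements, and its coordinate separates that pair; a
   one-element [A] yields the empty power. *)
pose I := {p : A * A | p.1 <> p.2}.
have sep (p : I) : {f : A -> Mn' n | is_hom f & f (sval p).1 <> f (sval p).2}.
  apply: cid2; exact: separating_hom (svalP p).
pose h a : prod_algebra (fun _ : I => Mn' n) := fun p => s2val (sep p) a.
apply: (KS _ _ h); last exact: KP.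
  by split=> *; apply: functional_extensionality_dep => p /=; rewrite /h;
    case: (s2valP (sep p)).
move=> a b hab; apply: contrapT => ab.
pose p : I := exist _ (a, b) ab.
by case: (s2valP' (sep p)); exact: (congr1 (fun g => g p) hab).
Qed.
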